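(* Let $\Pi$ be a (ground, non-disjunctive) program and let $X=\mathit{atoms}(\Pi)$. Let $\mathit{CS}_\Pi$ be the abstract solver graph whose vertices are all states relative to $X$ and whose edges are given by the transition rules $\mathit{Oracle}$, $\mathit{Fail}_{\mathit{chunk}}$, $\mathit{Find}$, $\mathit{Terminal}$ and $\mathit{Chunk}$ (defined in the context), with initial state $\emptyset_{X,\emptyset,\mathit{chunk}}$. Then $\mathit{CS}_\Pi$ solves cautious reasoning, i.e. $\mathit{CS}_\Pi$ is finite, no cycle is reachable from the initial state, and the unique terminal state reachable from the initial state is $\mathit{Ok}(\mathit{cautious}(\Pi))$.
   Context: Literals and programs. Fix a finite propositional signature. An atom $a$ is a positive literal; $\neg a$ is a negative literal. For a literal $l$, $\bar l=\neg a$ if $l=a$ and $\bar l=a$ if $l=\neg a$. For a set of atoms $X$, $\mathit{lit}(X)$ is the set of literals over atoms of $X$. For a set of literals $M$: $M^+$ is the set of its positive literals, $\overline{M}=\{\bar l\mid l\in M\}$, and $M$ is consistent if it contains no literal together with its negation; a consistent set $M$ is identified with the assignment mapping $a$ to true iff $a\in M$ and to false iff $\neg a\in M$. A rule is a pair $(A,B)$ written $A\leftarrow B$, where $B$ is a finite set of literals and $A$ is an atom or the empty set; $B^+$, $B^-$ denote the positive and negative literals of $B$. For a set of atoms $N$, ''$\leftarrow N$'' denotes the rule $(\emptyset,N)$ (a constraint). A program is a finite set of rules, $\mathit{atoms}(\Pi)$ the atoms occurring in it. A classical model of $\Pi$ is an assignment $M$ to $\mathit{atoms}(\Pi)$ such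 that for every rule $(A,B)\in\Pi$, $A\cap M\neq\emptyset$ or $B\not\subseteq M$. The reduct $\Pi^X$ w.r.t. a set of atoms $X$ is obtained by deleting each rule $A\leftarrow B^+,B^-$ with $X\cap\mathit{atoms}(B^-)\neq\emptyset$ and replacing each remaining rule by $A\leftarrow B^+$ (negation is negation by default). An answer set of $\Pi$ is an assignment $M$ to $\mathit{atoms}(\Pi)$ such that $M^+$ is minimal (w.r.t. inclusion) among the sets $M_0^+$ with $M_0$ a classical model of $\Pi^{M^+}$. $\mathit{cautious}(\Pi)=\bigcap_{M \text{ answer set of }\Pi}M^+$. States relative to $X$. Actions are: $\mathit{over}$, $\mathit{under}_\emptyset$, $\mathit{under}_{\{a\}}$ ($a\in X$), $\mathit{chunk}$, and $\mathit{chunk}_N$ ($N\subseteq X$). A record is a string of literals from $\mathit{lit}(X)$ without repetitions, also viewed as the set of its elements (so it may be consistent or inconsistent). States are: core states $L_{O,U,A}$ ($L$ a record, $O,U\subseteq X$, $A$ an action); control states $\mathit{Cont}(O,U)$ ($O,U\subseteq X$); terminal states $\mathit{Ok}(W)$ ($W\subseteq X$). For a core state, define the program $\Pi_{O,U,A}$ by: $\Pi_{O,U,\mathit{chunk}}=\Pi$, $\Pi_{O,U,\mathit{chunk}_N}=\Pi\cup\{\leftarrow N\}$. Transition rules (each gives an edge from the left state to the right state when the condition holds): - $\mathit{Oracle}$: $\emptyset_{O,U,A}\Rightarrow L'_{O,U,A}$, where $L'$ is any record that is an answer set of $\Pi_{O,U,A}$ if $\Pi_{O,U,A}$ has an answer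 set, and any inconsistent record otherwise. - $\mathit{Find}$: $L_{O,U,A}\Rightarrow \mathit{Cont}(O\cap L,U)$ if $L$ is consistent and $L\neq\emptyset$. - $\mathit{Fail}_{\mathit{chunk}}$: $L_{O,U,\mathit{chunk}_N}\Rightarrow\mathit{Cont}(O,U\cup N)$ if $L$ is inconsistent. - $\mathit{Terminal}$: $\mathit{Cont}(O,U)\Rightarrow\mathit{Ok}(O)$ if $O=U$. - $\mathit{Chunk}$: $\mathit{Cont}(O,U)\Rightarrow \emptyset_{O,U,\mathit{chunk}_N}$ if $N\subseteq O\setminus U$ and $N\neq\emptyset$. Abstract solver graph: vertices are all states relative to $X$; $(S,S')$ is an edge iff some listed transition rule allows $S\Rightarrow S'$. A state is reachable if there is a path to it from the initial state; a terminal state of the graph is one without outgoing edges. The graph solves cautious reasoning if it is finite, no reachable state is reachable from itself, and the unique terminal reachable state is $\mathit{Ok}(\mathit{cautious}(\Pi))$.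
   Formalization: The formal theorem assumes that Π has an answer set and that atoms(Π) is nonempty; otherwise the claim fails: for Π = {a ← ¬a} the inconsistent core state with action chunk is a reachable terminal state, and for Π = ∅ Oracle loops on the initial state. *)

(* Defs.v *)
From Stdlib Require Export Relation_Operators.
From mathcomp Require Export all_boot.

Set Implicit Arguments.
Unset Strict Implicit.
Unset Printing Implicit Defensive.

(* The finite propositional signature is a finType T of atoms. The literal a
   is (a, true), and its negation is (a, false). *)
Definition literal (T : finType) : Type := (T * bool)%type.

Section Programs.
Variable T : finType.

Definition neg_lit (l : literal T) : literal T := (l.1, ~~ l.2).

Definition lit (X : {set T}) : {set literal T} := [set l | l.1 \in X].

(* Sets of positive literals are identified with sets of atoms. *)
Definition pos (M : {set literal T}) : {set T} :=
  [set a | (a, true) \in M].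

Definition of_atoms (N : {set T}) : {set literal T} :=
  [set (a, true) | a in N].

Definition body_pos (B : {set literal T}) : {set literal T} :=
  [set l in B | l.2].

Definition body_neg (B : {set literal T}) : {set literal T} :=
  [set l in B | ~~ l.2].

Definition lits_atoms (M : {set literal T}) : {set T} := [set l.1 | l in M].

Definition consistent (M : {set literal T}) : bool :=
  [forall l in M, neg_lit l \notin M].

(* M, as an assignment, gives a value to the atoms of X and to no others. *)
Definition assignment_to (X : {set T}) (M : {set literal T}) : bool :=
  consistent M && (lits_atoms M == X).

(* A rule (A, B): the head None is the empty set. *)
Definition rule : Type := (option T * {set literal T})%type.

Definition program : Type := {set rule}.

Definition head (r : rule) : {set literal T} :=
  if r.1 is Some a then [set (a, true)] else set0.

Definition body (r : rule) : {set literal T} := r.2.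

Definition constraint (N : {set T}) : rule := (None, of_atoms N).

Definition atoms (P : program) : {set T} :=
  \bigcup_(r in P) (lits_atoms (head r) :|: lits_atoms (body r)).

Definition classical_model (P : program) (M : {set literal T}) : bool :=
  assignment_to (atoms P) M &&
  [forall r in P, (head r :&: M != set0) || ~~ (body r \subset M)].

Definition reduct (P : program) (X : {set T}) : program :=
  [set ((r.1, body_pos (body r)) : rule) | r in P
     & X :&: lits_atoms (body_neg (body r)) == set0].

(* As in the definition of classical_model, the models M0 of the reduct are
   assignments to the atoms of the reduct, possibly fewer than those of P. *)
Definition answer_set (P : program) (M : {set literal T}) : bool :=
  assignment_to (atoms P) M &&
  minset [pred Y : {set T} |
           [exists M0 : {set literal T},
              classical_model (reduct P (pos M)) M0 && (Y == pos M0)]]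
         (pos M).

Definition coherent (P : program) : bool :=
  [exists M : {set literal T}, answer_set P M].

(* The intersection is meaningful for coherent P only; on the empty family
   the big operator returns the whole signature. *)
Definition cautious (P : program) : {set T} :=
  \bigcap_(M : {set literal T} | answer_set P M) pos M.

End Programs.

Section States.
Variable T : finType.

Inductive action : Type :=
  | over
  | under_empty
  | under_atom of T
  | chunk
  | chunk_set of {set T}.

Inductive state : Type :=
  | Core (L : seq (literal T)) (Ov Un : {set T}) (A : action)
  | Cont (Ov Un : {set T})
  | Ok (W : {set T}).

Definition action_over (X : {set T}) (A : action) : bool :=
  match A with
  | under_atom a => a \in X
  | chunk_set N => N \subset X
  | _ => true
  end.

Definition elems (L : seq (literal T)) : {set literal T} := [set:: L].

Definition record_over (X : {set T}) (L : seq (literal T)) : bool :=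
  uniq L && (elems L \subset lit X).

Definition state_over (X : {set T}) (s : state) : bool :=
  match s with
  | Core L Ov Un A =>
      [&& record_over X L, Ov \subset X, Un \subset X & action_over X A]
  | Cont Ov Un => (Ov \subset X) && (Un \subset X)
  | Ok W => W \subset X
  end.

(* The program attached to a core state. It is specified for the chunk
   actions only, the others being produced by no rule of CS. *)
Definition core_program (P : program T) (Ov Un : {set T}) (A : action) :
    option (program T) :=
  match A with
  | chunk => Some P
  | chunk_set N => Some (constraint N |: P)
  | _ => None
  end.

Inductive step (P : program T) : state -> state -> Prop :=
  | Oracle (Ov Un : {set T}) A Q L of
      core_program P Ov Un A = Some Q
      & record_over (atoms P) L
      & (if coherent Q then answer_set Q (elems L)
         else ~~ consistent (elems L)) :
      step P (Core [::] Ov Un A) (Core L Ov Un A)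
  | Find L (Ov Un : {set T}) A of consistent (elems L) & L <> [::] :
      step P (Core L Ov Un A) (Cont (Ov :&: pos (elems L)) Un)
  | Fail_chunk L (Ov Un N : {set T}) of ~~ consistent (elems L) :
      step P (Core L Ov Un (chunk_set N)) (Cont Ov (Un :|: N))
  | Terminal (Ov Un : {set T}) of Ov = Un :
      step P (Cont Ov Un) (Ok Ov)
  | Chunk (Ov Un N : {set T}) of N \subset Ov :\: Un & N <> set0 :
      step P (Cont Ov Un) (Core [::] Ov Un (chunk_set N)).

Record graph : Type := Graph {
  vertex : state -> Prop;
  edge : state -> state -> Prop;
  initial : state }.

(* If P is incoherent, the run gets stuck: an inconsistent record with action
   chunk (as opposed to chunk_set N) has no outgoing edge. If P has no atoms
   and is coherent, Oracle loops on the empty record. *)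
Definition CS (P : program T) : graph := {|
  vertex := state_over (atoms P);
  edge := fun s s' =>
    [/\ state_over (atoms P) s, state_over (atoms P) s' & step P s s'];
  initial := Core [::] (atoms P) set0 chunk |}.

Definition finite_graph (G : graph) : Prop :=
  exists (n : nat) (enum_vertex : 'I_n -> state),
    forall s, vertex G s -> exists i, enum_vertex i = s.

Definition reachable (G : graph) (s : state) : Prop :=
  clos_refl_trans state (edge G) (initial G) s.

Definition terminal (G : graph) (s : state) : Prop :=
  forall s', ~ edge G s s'.

Definition acyclic_reachable (G : graph) : Prop :=
  forall s, reachable G s -> ~ clos_trans state (edge G) s s.

Definition solves_cautious_reasoning (P : program T) (G : graph) : Prop :=
  [/\ finite_graph G,
      acyclic_reachable G
    & forall s, (reachable G s /\ terminal G s) <-> s = Ok (cautious P)].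

End States.

Arguments over {T}.
Arguments under_empty {T}.
Arguments chunk {T}.

(* Main.v *)
Require Import Defs.
From mathcomp Require Import zify.

Set Implicit Arguments.
Unset Strict Implicit.
Unset Printing Implicit Defensive.

(** Every reachable state with sets [Ov] and [Un] satisfies
    [Un \subset cautious P \subset Ov].  The answer sets of [P] extended with the
    constraint [<- N] are the answer sets of [P] that do not include [N], so
    [Find] removes an atom of [N] from [Ov], whereas failure proves that
    [N \subset cautious P].  Either way [#|Ov :\: Un|] decreases at each oracle
    call on a chunk, so there is no cycle, and a run stops only when
    [Ov = Un = cautious P]. *)

Section AnswerSets.
Variable T : finType.
Implicit Types (P R : program T) (M : {set literal T}) (X Y N : {set T}).

(** * Sets of atoms as sets of positive literals, and positive models *)

Lemma in_pos M (a : T) : (a \in pos M) = ((a, true) \in M).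
Proof. by rewrite inE. Qed.

Lemma in_of_atoms N (l : literal T) : (l \in of_atoms N) = l.2 && (l.1 \in N).
Proof.
apply/imsetP/andP => [[a aN ->] //|[]].
by case: l => a [] //= _ aN; exists a.
Qed.

Lemma body_pos_of_atoms N : body_pos (of_atoms N) = of_atoms N.
Proof. by apply/setP => l; rewrite !inE in_of_atoms andbAC andbb. Qed.

Lemma body_neg_of_atoms N : body_neg (of_atoms N) = set0.
Proof. by apply/setP => l; rewrite !inE in_of_atoms; case: l.2; rewrite ?andbF. Qed.

Lemma lits_atoms_of_atoms N : lits_atoms (of_atoms N) = N.
Proof.
apply/setP => a; apply/imsetP/idP => [[l]|aN].
  by rewrite in_of_atoms => /andP[_ lN] ->.
by exists (a, true); rewrite ?in_of_atoms.
Qed.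

Lemma sub_of_atoms N Y : (of_atoms N \subset of_atoms Y) = (N \subset Y).
Proof.
apply/subsetP/subsetP => NY => [a aN|l].
  by have := NY (a, true); rewrite !in_of_atoms /=; apply.
by rewrite !in_of_atoms => /andP[-> /NY].
Qed.

(** Satisfaction of [r] by any assignment whose true atoms are [Y], provided the body of [r] has
    only positive literals, as in a reduct. *)
Definition holds Y (r : rule T) : bool :=
  (if r.1 is Some a then a \in Y else false) || ~~ (body r \subset of_atoms Y).

Definition positive_model R Y : bool :=
  (Y \subset atoms R) && [forall r in R, holds Y r].

Lemma pos_subset_atoms X M : assignment_to X M -> pos M \subset X.
Proof.
case/andP=> _ /eqP <-; apply/subsetP => a; rewrite in_pos => aM.
by apply/imsetP; exists (a, true).
Qed.

Lemma holdsE M (r : rule T) : body_pos (body r) = body r ->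
  (head r :&: M != set0) || ~~ (body r \subset M) = holds (pos M) r.
Proof.
move=> rpos; rewrite /holds; congr (_ || ~~ _).
  case: r {rpos} => [[a|] B] /=; rewrite /head /=; last by rewrite set0I eqxx.
  rewrite in_pos; apply/set0Pn/idP => [[l]|aM].
    by rewrite !inE => /andP[/eqP ->].
  by exists (a, true); rewrite !inE eqxx.
apply/subsetP/subsetP => sub l lr; have := sub l lr.
  move: lr; rewrite -{1}rpos inE in_of_atoms in_pos => /andP[_].
  by case: l => a [].
by rewrite in_of_atoms in_pos; case: l {lr} => a [].
Qed.

(** This trades assignments for their sets of true atoms, on which the minimality of answer sets is
    stated. *)
Lemma positive_modelP R Y : (forall r, r \in R -> body_pos (body r) = body r) ->
  [exists M : {set literal T}, classical_model R M && (Y == pos M)]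
    = positive_model R Y.
Proof.
move=> Rpos; apply/existsP/andP => [[M /andP[/andP[MR /forall_inP Msat] /eqP->]]|].
  split; first exact: pos_subset_atoms MR.
  by apply/forall_inP => r rR; rewrite -holdsE ?Msat // Rpos.
case=> YR /forall_inP Ysat.
(* [M] makes the atoms of [R] outside [Y] false. *)
pose M : {set literal T} := [set l | (l.1 \in atoms R) && (l.2 == (l.1 \in Y))].
have posM : pos M = Y.
  apply/setP => a; rewrite !inE /= eq_sym eqb_id andbC.
  by case: (boolP (a \in Y)) => //= /(subsetP YR).
exists M; rewrite posM eqxx andbT; apply/andP; split; last first.
  by apply/forall_inP => r rR; rewrite holdsE ?posM ?Ysat // Rpos.
apply/andP; split.
  apply/forall_inP => -[a b]; rewrite !inE /= => /andP[-> /eqP->] /=.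
  by case: (a \in Y).
apply/eqP/setP => a; apply/imsetP/idP => [[l]|aR].
  by rewrite inE => /andP[lR _] ->.
by exists (a, a \in Y); rewrite ?inE /= ?aR ?eqxx.
Qed.

Lemma reduct_positive P X r : r \in reduct P X -> body_pos (body r) = body r.
Proof.
by case/imsetP=> r' _ ->; apply/setP => l; rewrite !inE -andbA andbb.
Qed.

Lemma answer_setP P M :
  reflect [/\ assignment_to (atoms P) M, positive_model (reduct P (pos M)) (pos M)
    & forall Y, positive_model (reduct P (pos M)) Y -> Y \subset pos M ->
        Y = pos M]
  (answer_set P M).
Proof.
have modelE Y := positive_modelP Y (@reduct_positive P (pos M)).
apply: (iffP andP) => [[MP /minsetP[/= MR Mmin]]|[MP MR Mmin]].
  by split=> // [|Y YR]; [rewrite -modelE | apply: Mmin; rewrite /= modelE].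
split=> //; apply/minsetP; split=> [|Y /=]; rewrite /= modelE //.
exact: Mmin.
Qed.

(** * Effect of a constraint on answer sets *)

Lemma reduct_constraint P X N :
  reduct (constraint N |: P) X = constraint N |: reduct P X.
Proof.
have cE : (None, body_pos (body (constraint N))) = constraint N.
  by rewrite /body /= body_pos_of_atoms.
apply/setP => r; rewrite in_setU1.
apply/imsetP/orP => [[r']|[/eqP->|/imsetP[r']]].
- rewrite !inE => /andP[/orP[/eqP->|r'P] r'X] ->; first by left; rewrite cE.
  by right; apply/imsetP; exists r'; rewrite // inE r'P.
- exists (constraint N); last by rewrite cE.
  by rewrite !inE eqxx /body /= body_neg_of_atoms /lits_atoms imset0 setI0 eqxx.
- rewrite inE => /andP[r'P r'X] ->; exists r' => //.
  by rewrite !inE r'P orbT.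
Qed.

Lemma atoms_constraint P N : atoms (constraint N |: P) = N :|: atoms P.
Proof.
rewrite /atoms bigcup_setU big_set1 /head /body /= lits_atoms_of_atoms.
by rewrite /lits_atoms imset0 set0U.
Qed.

Lemma positive_model_constraint R N Y :
  positive_model (constraint N |: R) Y =
  [&& Y \subset N :|: atoms R, ~~ (N \subset Y) & [forall r in R, holds Y r]].
Proof.
rewrite /positive_model atoms_constraint; congr (_ && _).
have cE : holds Y (constraint N) = ~~ (N \subset Y).
  by rewrite /holds /= sub_of_atoms.
apply/forall_inP/andP => [Ysat|[NY /forall_inP Ysat] r].
  split; first by rewrite -cE Ysat // setU11.
  by apply/forall_inP => r rR; rewrite Ysat // setU1r.
by rewrite in_setU1 => /orP[/eqP->|/Ysat //]; rewrite cE.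
Qed.

(* Atoms of [Y] that do not occur in [R] are irrelevant to its rules. *)
Lemma holds_restrict R Y (r : rule T) : r \in R ->
  holds Y r -> holds (Y :&: atoms R) r.
Proof.
move=> rR; have atR : lits_atoms (head r) :|: lits_atoms (body r) \subset atoms R.
  exact: (bigcup_sup r).
case/orP=> [rY|rY]; apply/orP.
  left; case: r rR atR rY => [[a|//] B] /= rR atR aY.
  rewrite inE aY /=; apply: (subsetP atR); rewrite inE.
  by apply/orP; left; apply/imsetP; exists (a, true); rewrite // /head /= inE.
right; apply: contra rY => /subset_trans; apply; rewrite sub_of_atoms.
exact: subsetIl.
Qed.

(** [pos M] satisfies the constraint iff it does not include [N], a property inherited by subsets,
    so minimality is tested against the same sets. The constraint does, however, add [N] to the
    atoms of the reduct. *)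
Lemma answer_set_constraint P N M : N \subset atoms P ->
  answer_set (constraint N |: P) M = answer_set P M && ~~ (N \subset pos M).
Proof.
move=> NP; have atE : atoms (constraint N |: P) = atoms P.
  by rewrite atoms_constraint; apply/setUidPr.
apply/answer_setP/andP; rewrite atE reduct_constraint.
  set R := reduct P (pos M); move=> [MP].
  rewrite positive_model_constraint => /and3P[MNR NM Msat] Mmin.
  (* Atoms of [N] may be missing from [R]. Minimality keeps them out of [pos M], since the
     restriction of [pos M] to the atoms of [R] is still a model. *)
  have MR : pos M \subset atoms R.
    apply/setIidPl/Mmin; last exact: subsetIl.
    rewrite positive_model_constraint; apply/and3P; split.
    - by rewrite (subset_trans _ (subsetUr _ _)) // subsetIr.
    - by apply: contra NM => /subset_trans; apply; apply: subsetIl.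
    - apply/forall_inP => r rR; apply: holds_restrict => //.
      by move/forall_inP: Msat; apply.
  split=> //; apply/answer_setP; split=> // [|Y /andP[YR Ysat] YM].
    by rewrite /positive_model MR.
  apply: Mmin => //; rewrite positive_model_constraint Ysat andbT.
  rewrite (subset_trans YR (subsetUr _ _)) /=.
  by apply: contra NM => /subset_trans; apply.
case=> /answer_setP; set R := reduct P (pos M); move=> [MP /andP[MR Msat] Mmin] NM.
split=> // [|Y]; rewrite positive_model_constraint.
  by rewrite NM Msat (subset_trans MR (subsetUr _ _)).
move=> /and3P[_ _ Ysat] YM; apply: Mmin => //.
by rewrite /positive_model Ysat (subset_trans YM).
Qed.

Lemma answer_set_assignment P M : answer_set P M -> assignment_to (atoms P) M.
Proof. by case/andP. Qed.

Lemma cautious_sub_pos P M : answer_set P M -> cautious P \subset pos M.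
Proof. exact: bigcap_inf. Qed.

Lemma cautious_sub_atoms P : coherent P -> cautious P \subset atoms P.
Proof.
case/existsP=> M MP; apply: subset_trans (cautious_sub_pos MP) _.
exact/pos_subset_atoms/answer_set_assignment.
Qed.

(** An answer set of [P] not including [N] would survive the constraint. *)
Lemma incoherent_constraint_cautious P N : N \subset atoms P ->
  ~~ coherent (constraint N |: P) -> N \subset cautious P.
Proof.
move=> NP /existsPn incoh; apply/bigcapsP => M MP.
by have := incoh M; rewrite answer_set_constraint // MP /= negbK.
Qed.

(** * Answers of the oracle *)

Lemma elems_enum M : elems (enum M) = M.
Proof. by apply/setP => l; rewrite inE mem_enum. Qed.

Lemma consistent_nil : consistent (elems (Nil (literal T))).
Proof. by apply/forall_inP => l; rewrite inE. Qed.

Definition oracle_output P (L : seq (literal T)) : bool :=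
  if coherent P then answer_set P (elems L) else ~~ consistent (elems L).

(** The empty record is consistent, and as an assignment it covers no atom; so it suits neither
    outcome and [Oracle] cannot loop on it. *)
Lemma oracle_output_neq_nil P L : atoms P != set0 ->
  oracle_output P L -> L <> [::].
Proof.
move=> Pn0 + L0; rewrite L0 /oracle_output consistent_nil; case: ifP => // _.
case/andP=> /andP[_ /eqP atP] _; case/eqP: Pn0; rewrite -atP.
by apply/setP => a; rewrite inE; apply/imsetP => -[l]; rewrite inE.
Qed.

Lemma ex_oracle_output P : atoms P != set0 ->
  exists2 L, record_over (atoms P) L & oracle_output P L.
Proof.
case/set0Pn=> a aP; rewrite /oracle_output.
have [/existsP[M MP]|_] := boolP (coherent P).
  exists (enum M); rewrite ?/record_over elems_enum // enum_uniq /=.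
  apply/subsetP => l lM; rewrite inE.
  by case/andP: MP => /andP[_ /eqP <-] _; apply: imset_f.
(* An incoherent program calls for an inconsistent record: an atom together with its negation. *)
exists [:: (a, true); (a, false)].
  rewrite /record_over /= inE /= xpair_eqE andbF /=.
  by apply/subsetP => l; rewrite !inE => /orP[]/eqP->.
by apply/forall_inP => /(_ (a, true)); rewrite !inE !eqxx /= orbT => /(_ isT).
Qed.

End AnswerSets.

(** * Invariant, rank and progress along runs *)

Section Runs.
Variables (T : finType) (P : program T).
Hypotheses (atoms_nonempty : atoms P != set0) (P_coherent : coherent P).
Implicit Types (Ov Un N : {set T}) (s : state T).

Definition bounds Ov Un : bool := (Un \subset cautious P) && (cautious P \subset Ov).

(** A record is empty before the oracle call and an oracle answer after it. Actions that no rule of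
    [CS] introduces are excluded. *)
Definition invariant s : Prop :=
  state_over (atoms P) s /\
  match s with
  | Core L Ov Un chunk => bounds Ov Un /\ (L = [::] \/ oracle_output P L)
  | Core L Ov Un (chunk_set N) =>
      [/\ bounds Ov Un, N \subset Ov :\: Un, N != set0
        & L = [::] \/ oracle_output (constraint N |: P) L]
  | Core _ _ _ _ => False
  | Cont Ov Un => bounds Ov Un
  | Ok W => W = cautious P
  end.

(* A core state holding an oracle answer on a chunk gets less than the value
   of its control predecessor and more than that of its successor, whose
   difference [Ov :\: Un] is strictly smaller. *)
Definition rank s : nat :=
  match s with
  | Core L Ov Un chunk => 3 * #|Ov :\: Un| + (if L is [::] then 3 else 2)
  | Core L Ov Un _ =>
      if L is [::] then 3 * #|Ov :\: Un| else 3 * #|Ov :\: Un|.-1 + 2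
  | Cont Ov Un => 3 * #|Ov :\: Un| + 1
  | Ok _ => 0
  end.

Lemma invariant_initial : invariant (initial (CS P)).
Proof.
split=> /=; last by rewrite /bounds sub0set cautious_sub_atoms //; split=> //; left.
rewrite /record_over /= subxx sub0set !andbT.
by apply/subsetP => l; rewrite inE.
Qed.

Lemma chunk_atoms Ov Un N : Ov \subset atoms P -> N \subset Ov :\: Un ->
  atoms (constraint N |: P) = atoms P.
Proof.
move=> OP NOU; rewrite atoms_constraint; apply/setUidPr.
exact: subset_trans NOU (subset_trans (subsetDl _ _) OP).
Qed.

(** The record, being consistent, is an answer set omitting some atom of [N]; [Find] drops that atom
    from [Ov], and it lay outside [Un]. *)
Lemma card_find Ov Un N L : Ov \subset atoms P -> N \subset Ov :\: Un ->
  oracle_output (constraint N |: P) L -> consistent (elems L) ->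
  #|(Ov :&: pos (elems L)) :\: Un| < #|Ov :\: Un|.
Proof.
move=> OP NOU; rewrite /oracle_output; case: ifP => _; last by move/negP.
have NP : N \subset atoms P.
  exact: subset_trans NOU (subset_trans (subsetDl _ _) OP).
rewrite answer_set_constraint // => /andP[_ /subsetPn[a aN aL]] _.
apply: proper_card; apply/properP; split.
  by apply: setSD; apply: subsetIl.
exists a; first exact: (subsetP NOU).
by rewrite in_setD in_setI (negPf aL) !andbF.
Qed.

Lemma card_fail Ov Un N : N \subset Ov :\: Un -> N != set0 ->
  #|Ov :\: (Un :|: N)| < #|Ov :\: Un|.
Proof.
move=> NOU /set0Pn[a aN]; apply: proper_card; apply/properP; split.
  by apply: setDS; apply: subsetUl.
by exists a; [apply: (subsetP NOU) | rewrite !inE aN orbT].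
Qed.

(** An answer set of [Q] bounds [cautious P] from above; [Q] will be [P] itself or [P] with a
    constraint. *)
Lemma bounds_find Ov Un L (Q : program T) : bounds Ov Un ->
  (forall M, answer_set Q M -> answer_set P M) -> oracle_output Q L ->
  consistent (elems L) -> bounds (Ov :&: pos (elems L)) Un.
Proof.
move=> /andP[UC CO] QP; rewrite /oracle_output.
case: ifP => _; last by move/negP.
by move=> /QP LP _; rewrite /bounds UC subsetI CO cautious_sub_pos.
Qed.

Lemma invariant_edge s s' : invariant s -> edge (CS P) s s' ->
  invariant s' /\ rank s' < rank s.
Proof.
move=> inv [_ s'P st]; case: st inv s'P => {s s'}.
- move=> Ov Un A Q L AQ LP Lout [/= /and4P[_ OP UP AP] inv] s'P.
  case: A AQ AP inv s'P => //= [[QE]|N [QE]] _.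
    rewrite -QE in Lout; move=> [OU _] s'P; split; first by do 2?split=> //; right.
    by case: L Lout {LP s'P} => [/oracle_output_neq_nil|*]; [case|lia].
  rewrite -QE in Lout; case=> OU NOU Nn0 _ s'P.
  split; first by split=> //; split=> //; right.
  (* With [n] the size of [Ov :\: Un], which includes the nonempty [N], the predecessor in [rank] is
     not truncated: the rank falls from [3 * n] to [3 * n - 1]. *)
  have: #|Ov :\: Un| > 0 by rewrite (leq_trans _ (subset_leq_card NOU)) // card_gt0.
  case: L Lout {LP s'P} => [/oracle_output_neq_nil|*]; last by lia.
  by rewrite (chunk_atoms OP NOU) => /(_ atoms_nonempty).
- move=> L Ov Un A Lcons Ln0 [/= /and4P[_ OP UP AP] inv] s'P.
  case: A AP inv => //= [_ [OU []] //|N NP [OU NOU Nn0 []] //] Lout.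
    split; first by split=> //; apply: (bounds_find OU _ Lout).
    (* After a [chunk] call the difference may stay the same; the rank still falls, as its constant
       goes from 2 to 1. *)
    have: #|(Ov :&: pos (elems L)) :\: Un| <= #|Ov :\: Un|.
      by apply/subset_leq_card/setSD/subsetIl.
    by case: L {Lcons Lout s'P} Ln0 => // *; lia.
  have lt_card := card_find OP NOU Lout Lcons.
  split; last by case: L {Lcons Lout s'P} Ln0 lt_card => // *; lia.
  split=> //; apply: (bounds_find OU _ Lout) => // M.
  by rewrite answer_set_constraint // => /andP[].
- move=> L Ov Un N Lincons [/= /and4P[_ OP UP NP] [/andP[UC CO] NOU Nn0 Lout]] s'P.
  have lt_card := card_fail NOU Nn0.
  case: Lout => [L0|Lout]; first by rewrite L0 consistent_nil in Lincons.
  split; last by case: L Lincons {s'P Lout} => [|*]; [rewrite consistent_nil|lia].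
  split=> //; rewrite /= /bounds CO andbT subUset UC /=.
  (* Were the extended program coherent, the record would be one of its answer sets, hence
     consistent. *)
  apply: incoherent_constraint_cautious => //; apply/negP => coh.
  move: Lout; rewrite /oracle_output coh => /answer_set_assignment/andP[].
  by rewrite (negPf Lincons).
(* [Un], [cautious P] and [Ov] form a chain of inclusions, so [Ov = Un] makes all three equal. *)
- move=> Ov Un OU [_ /= /andP[]]; rewrite -OU => OC CO s'P.
  by split; [split=> //; apply/eqP; rewrite eqEsubset OC | lia].
- move=> Ov Un N NOU Nn0 [OUP inv] s'P; split; last by rewrite /=; lia.
  by split=> //; split=> //; [apply/eqP | left].
Qed.

(** [Oracle] applies to an empty record, [Find] or [Fail_chunk] to an answer, [Terminal] or [Chunk]
    to a control state. Coherence of [P] rules out an inconsistent answer under [chunk], where the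
    run would be stuck. *)
Lemma invariant_progress s : invariant s ->
  s = Ok (cautious P) \/ exists s', edge (CS P) s s'.
Proof.
have oracle_step L Ov Un A (Q : program T) : core_program P Ov Un A = Some Q ->
    state_over (atoms P) (Core L Ov Un A) -> atoms Q = atoms P ->
    L = [::] -> exists s', edge (CS P) (Core L Ov Un A) s'.
  move=> AQ sP QP L0; rewrite L0 in sP *.
  have [|L' L'P L'out] := @ex_oracle_output _ Q; first by rewrite QP.
  rewrite QP in L'P; exists (Core L' Ov Un A).
  split=> //; last exact: Oracle AQ L'P L'out.
  by move: sP; rewrite /= L'P => /andP[_ ->].
have find_step L Ov Un A : state_over (atoms P) (Core L Ov Un A) ->
    consistent (elems L) -> L <> [::] -> exists s', edge (CS P) (Core L Ov Un A) s'.
  move=> sP Lcons Ln0; exists (Cont (Ov :&: pos (elems L)) Un); split=> //.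
    case/and4P: sP => _ OP UP _; rewrite /= UP andbT.
    exact: subset_trans (subsetIl _ _) OP.
  exact: Find.
case: s => [L Ov Un A|Ov Un|W] [sP]; last by left; congr Ok.
- case: A sP => // [sP [OU Lout]|N sP [OU NOU Nn0 Lout]]; right.
    case: Lout => [|Lout]; first exact: oracle_step.
    apply: find_step => //; last exact: oracle_output_neq_nil Lout.
    move: Lout; rewrite /oracle_output P_coherent.
    by move=> /answer_set_assignment/andP[].
  have [_ OP UP NP] := and4P sP.
  have QP := chunk_atoms OP NOU.
  case: Lout => [|Lout].
    exact: (oracle_step _ _ _ (chunk_set N) _ erefl sP QP).
  have Ln0 : L <> [::] by apply: oracle_output_neq_nil Lout; rewrite QP.
  have [Lcons|Lincons] := boolP (consistent (elems L)); first exact: find_step.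
  exists (Cont Ov (Un :|: N)); split=> //; last exact: Fail_chunk.
  by rewrite /= OP subUset UP.
- move=> /andP[UC CO]; right; have [OU|OU] := eqVneq Ov Un.
    exists (Ok Ov); split=> //; last exact: Terminal.
    by case/andP: sP.
  (* The largest chunk will do; it is nonempty since [Un] is included in [Ov] and differs from
     it. *)
  exists (Core [::] Ov Un (chunk_set (Ov :\: Un))); split=> //.
    have /andP[OP UP] := sP; rewrite /= OP UP /record_over /=.
    rewrite (subset_trans (subsetDl _ _) OP) !andbT.
    by apply/subsetP => l; rewrite inE.
  apply: Chunk => // /eqP; rewrite setD_eq0 => OsubU; case/eqP: OU.
  by apply/eqP; rewrite eqEsubset OsubU (subset_trans UC).
Qed.

Lemma reachable_invariant s : reachable (CS P) s -> invariant s.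
Proof.
rewrite /reachable => reach; have := invariant_initial.
elim: reach => // [x y xy invx|x y z _ IHxy _ IHyz /IHxy/IHyz //].
by have [] := invariant_edge invx xy.
Qed.

Lemma path_rank s s' : clos_trans _ (edge (CS P)) s s' -> invariant s ->
  invariant s' /\ rank s' < rank s.
Proof.
elim=> [x y xy /invariant_edge/(_ xy) //|x y z _ IHxy _ IHyz].
case/IHxy=> [/IHyz[invz yz] xy].
by split=> //; apply: ltn_trans xy.
Qed.

(** Strong induction on the rank: any other invariant state has a successor of smaller rank. *)
Lemma invariant_reaches_Ok s : invariant s ->
  clos_refl_trans _ (edge (CS P)) s (Ok (cautious P)).
Proof.
have [n] := ubnP (rank s); elim: n s => // n IHn s le_sn inv_s.
have [->|[s' ss']] := invariant_progress inv_s; first exact: rt_refl.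
have [inv_s' lt_s's] := invariant_edge inv_s ss'.
apply: (rt_trans _ _ _ s'); first exact: rt_step.
by apply: IHn => //; apply: leq_trans lt_s's _.
Qed.

Lemma Ok_terminal W : terminal (CS P) (Ok W).
Proof. by move=> s' [_ _ st]; inversion st. Qed.

End Runs.

(** * Finiteness of the graph *)

Lemma finite_CS (T : finType) (P : program T) : finite_graph (CS P).
Proof.
(* Every vertex has a code in a finite type: a record has no repetitions, so its length is at most
   the number of literals. *)
pose code : finType :=
  (({bseq #|{: literal T}| of literal T} * {set T} * {set T}
    * option (option (option (T + {set T}))))
   + {set T} * {set T} + {set T})%type.
pose decode_action (c : option (option (option (T + {set T})))) : action T :=
  match c with
  | None => over
  | Some None => under_empty
  | Some (Some None) => chunk
  | Some (Some (Some (inl a))) => under_atom a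
  | Some (Some (Some (inr N))) => chunk_set N
  end.
pose decode (c : code) : state T :=
  match c with
  | inl (inl (L, Ov, Un, A)) => Core L Ov Un (decode_action A)
  | inl (inr (Ov, Un)) => Cont Ov Un
  | inr W => Ok W
  end.
have decode_actionK A : exists c, decode_action c = A.
  case: A => [||a||N]; [by exists None | by exists (Some None) | | |].
  - by exists (Some (Some (Some (inl a)))).
  - by exists (Some (Some None)).
  - by exists (Some (Some (Some (inr N)))).
exists #|code|, (fun i => decode (enum_val i)) => s sP.
suff [c <-] : exists c, decode c = s.
  by exists (enum_rank c); rewrite enum_rankK.
case: s sP => [L Ov Un A /and4P[/andP[Luniq _] _ _ _]|Ov Un _|W _].
- have [c <-] := decode_actionK A.
  have Lsize : size L <= #|{: literal T}| by rewrite -(card_uniqP Luniq) max_card.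
  by exists (inl (inl (Bseq Lsize, Ov, Un, c))).
- by exists (inl (inr (Ov, Un))).
- by exists (inr W).
Qed.

Theorem theorem1 (T : finType) (P : program T)
    (atoms_nonempty : atoms P <> set0) (P_coherent : coherent P) :
  solves_cautious_reasoning P (CS P).
Proof.
have Pn0 : atoms P != set0 by apply/eqP.
split; first exact: finite_CS.
  move=> s /(reachable_invariant Pn0 P_coherent) inv_s cyc.
  by have [_] := path_rank Pn0 P_coherent cyc inv_s; rewrite ltnn.
move=> s; split=> [[/(reachable_invariant Pn0 P_coherent) inv_s term]|->].
  have [//|[s' ss']] := invariant_progress Pn0 P_coherent inv_s.
  by case: (term s').
split; last exact: Ok_terminal.
by apply: invariant_reaches_Ok => //; apply: invariant_initial.
Qed.
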